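(* Let $a \in (0,1)$ be the binary Champernowne constant (with binary expansion $0.11011100101\ldots$) or any other number in $(0,1)$ whose binary expansion contains all possible finite strings of zeroes and ones. Let $p_* := \log(2\pi a) + \frac{\pi}{2} i$ and $\alpha_* := \frac{\log 2}{2\pi}$. Then $$\overline{\exp \circ \exp (L_{\alpha_*}(p_* ))} = \mathbb{C}.$$
   Context: Here $\exp : \mathbb{C} \to \mathbb{C}$, $z \mapsto e^z$, is the complex exponential and $\log$ is the real natural logarithm. For $p \in \mathbb{C}$ and $\alpha \in \mathbb{R}$, $L_\alpha(p) := \{p + t(i+\alpha) : t \in \mathbb{R}\}$. The overline denotes closure in $\mathbb{C}$. The binary Champernowne constant is the number whose binary expansion after the point is the concatenation of the binary representations of $1, 2, 3, \ldots$; its binary expansion contains every finite string of zeroes and ones. *)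

(* Defs.v *)
From HB Require Import structures.
From mathcomp Require Import all_boot all_order all_algebra.
From mathcomp Require Import all_classical all_reals all_analysis.
From mathcomp Require Export complex.

Set Implicit Arguments.
Unset Strict Implicit.
Unset Printing Implicit Defensive.

Import Order.TTheory GRing.Theory Num.Theory numFieldNormedType.Exports.

Local Open Scope classical_set_scope.
Local Open Scope ring_scope.
Local Open Scope complex_scope.

(* The complex plane is the regular module [R[i]^o]:
   [R[i]] itself is not declared as a topological space, while [R[i]^o] carries
   the topology of the complex modulus. *)

(* Euler's formula: exp (x + iy) = e^x (cos y + i sin y). *)
Definition cexp {R : realType} (z : R[i]^o) : R[i]^o :=
  let: x +i* y := z in (expR x)%:C * (cos y +i* sin y).

Definition line {R : realType} (alpha : R) (p : R[i]^o) : set R[i]^o :=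
  [set p + t%:C * ('i%C + alpha%:C) | t in [set: R]].

(* Digits are indexed from 0, so the digit [b n] has weight 2^-(n+1). *)
Definition binary_series {R : realType} (b : nat -> bool) : R^nat :=
  series (fun n => (b n)%:R / 2 ^+ n.+1).

Definition binary_expansion {R : realType} (b : nat -> bool) (a : R) : Prop :=
  binary_series b @ \oo --> a.

Definition contains_string (b : nat -> bool) (w : seq bool) : Prop :=
  exists n : nat, mkseq (fun i => b (n + i)%N) (size w) = w.

(* A dyadic rational has two binary expansions, but both are eventually
   constant; hence a number with an expansion containing all strings has only
   that expansion. *)
Definition expansion_contains_all_strings {R : realType} (a : R) : Prop :=
  exists2 b : nat -> bool,
    binary_expansion b a & forall w : seq bool, contains_string b w.

(* Most significant digit first; intended for [0 < n]. *)
Definition binary_repr (n : nat) : seq bool :=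
  rev (mkseq (fun i => odd (n %/ 2 ^ i)) (trunc_log 2 n).+1).

(* Each [binary_repr k] is nonempty, so those of 1, ..., n+1 already determine
   the digit of index [n] of the infinite concatenation. *)
Definition champernowne_digit (n : nat) : bool :=
  nth false (flatten [seq binary_repr k | k <- iota 1 n.+1]) n.

Definition champernowne (R : realType) : R :=
  limn (binary_series champernowne_digit).

(* Main.v *)
Require Import Defs.
From mathcomp Require Import all_boot all_order all_algebra.
From mathcomp Require Import all_classical all_reals all_analysis.
From mathcomp Require Import ring lra.

Import Order.TTheory GRing.Theory Num.Theory numFieldNormedType.Exports.
Local Open Scope classical_set_scope.
Local Open Scope ring_scope.
Local Open Scope complex_scope.

(** Write [A = 2 pi a] and [alpha = ln 2 / (2 pi)].  The first exponential turns
    the line into a logarithmic spiral,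
      [exp (p + t (i + alpha)) = A e^(alpha t) (- sin t + i cos t)],
    whose modulus doubles at each full turn.  Near the [n]-th crossing of the
    positive imaginary axis, at the parameter [t = 2 pi n + tau h] with
    [h = 2^-n] and [tau] fixed, this point is
      [- A e^(alpha tau h) sin (tau h) / h + i A e^(alpha tau h) cos (tau h) / h].
    As [n] grows, the real part is a difference quotient tending to [- A tau];
    the imaginary part is [A 2^n] plus a difference quotient tending to
    [A alpha tau] ([line_exp], [cvg_diff_quotient]).  The second exponential
    sees the imaginary part modulo [2 pi] only, and [A 2^n = 2 pi (2^n a)]: up
    to the turns that it forgets, it sees the fractional part of [2^n a].

    Multiplying by 2 modulo 1 shifts the binary digits of [a].  Since these
    contain every finite string, the fractional parts of [2^n a] come arbitrarily
    close to any [phi] between 0 and 1, along exponents tending to infinity because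
    the required string may be preceded by arbitrary padding
    ([doubling_orbit_dense]).  So [tau] adjusts the modulus of the limit and
    [phi] its argument: every value of the exponential, that is every nonzero
    complex number, is a limit ([cexp_in_closure]), and then so is 0.

    The Champernowne number is covered because the string [w] occurs inside
    the binary representation of the integer whose digits are [true :: w]
    ([champernowne_contains_string]). *)

(** * Strings in the Champernowne expansion *)

Lemma mkseq_recl {T : Type} (f : nat -> T) (n : nat) :
  mkseq f n.+1 = f 0%N :: mkseq (f \o S) n.
Proof. by rewrite /mkseq/= (iotaDl 1 0) -map_comp. Qed.

Lemma binary_repr_rcons (k : nat) (d : bool) :
  (0 < k)%N -> binary_repr (d + k.*2) = rcons (binary_repr k) d.
Proof.
move=> k0; rewrite /binary_repr.
have -> : trunc_log 2 (d + k.*2) = (trunc_log 2 k).+1.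
  rewrite trunc_log2S ?half_bit_double//.
  by case: k k0 => [//|k _]; rewrite doubleS !addnS.
rewrite mkseq_recl rev_cons; congr (rcons (rev _) _); last first.
  by rewrite expn0 divn1 oddD odd_double addbF oddb.
apply: eq_map => i /=.
by rewrite expnS divnMA divn2 half_bit_double.
Qed.

Lemma binary_repr_surj (w : seq bool) :
  exists2 k, (0 < k)%N & binary_repr k = true :: w.
Proof.
elim/last_ind: w => [|w d [k k0 kw]]; first by exists 1%N.
exists (d + k.*2)%N; first by rewrite addn_gt0 double_gt0 k0 orbT.
by rewrite binary_repr_rcons// kw.
Qed.

(** The digit of index [j] is read off the block list of 1, ..., j+1, and the
    block lists are prefixes of one another, so any list long enough to have an
    entry at [j] gives the same digit. *)
Lemma champernowne_digitE (m j : nat) :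
  (j < size (flatten [seq binary_repr k | k <- iota 1 m]))%N ->
  champernowne_digit j = nth false (flatten [seq binary_repr k | k <- iota 1 m]) j.
Proof.
have size_ge p : (p <= size (flatten [seq binary_repr k | k <- iota 1 p]))%N.
  rewrite size_flatten sumnE big_map -[X in (X <= _)%N](size_iota 1) big_map -sum1_size.
  by apply: leq_sum => k _; rewrite size_rev size_mkseq.
have nth_prefix p q : (p <= q)%N ->
    (j < size (flatten [seq binary_repr k | k <- iota 1 p]))%N ->
    nth false (flatten [seq binary_repr k | k <- iota 1 q]) j =
    nth false (flatten [seq binary_repr k | k <- iota 1 p]) j.
  by move=> /subnKC <- jp; rewrite iotaD map_cat flatten_cat nth_cat jp.
move=> jm; rewrite /champernowne_digit.
by case: (leqP j.+1 m) => jm'; [rewrite (nth_prefix j.+1 m)|rewrite (nth_prefix m j.+1)// ltnW].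
Qed.

(** The leading [true] of the block [true :: w] makes it the representation
    of an integer even if [w] starts with zeros; [w] itself starts one position
    later. *)
Lemma champernowne_contains_string (w : seq bool) :
  contains_string champernowne_digit w.
Proof.
have [[//|k] _ kw] := binary_repr_surj w.
pose s := flatten [seq binary_repr i | i <- iota 1 k].
have sE : flatten [seq binary_repr i | i <- iota 1 k.+1] = s ++ true :: w.
  by rewrite -[k.+1]addn1 iotaD map_cat flatten_cat /= add1n kw cats0.
exists (size s).+1; apply: (@eq_from_nth _ false); rewrite size_mkseq// => i iw.
rewrite nth_mkseq// (champernowne_digitE k.+1) sE.
  by rewrite addSnnS nth_cat ltnNge leq_addr/= addKn.
by rewrite addSnnS size_cat ltn_add2l.
Qed.

(** * Binary expansions and multiplication by 2 modulo 1 *)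

(** Self-similarity of binary expansions, from which all facts about them follow
    by induction over the digits with [b] generalized. *)
Lemma binary_series_recl {R : realType} (b : nat -> bool) (n : nat) :
  binary_series b n.+1 = ((b 0)%:R + binary_series (b \o S) n) / 2 :> R.
Proof.
rewrite /binary_series /series/= big_nat_recl// expr1 mulrDl mulr_suml.
by congr (_ + _); apply: eq_bigr => i _; rewrite exprSr invfM mulrA.
Qed.

Lemma binary_series_itv {R : realType} (b : nat -> bool) (n : nat) :
  0 <= @binary_series R b n <= 1.
Proof.
elim: n b => [|n IH] b; first by rewrite /binary_series /series/= big_geq// lexx ler01.
by rewrite binary_series_recl; move: (IH (b \o S)); case: (b 0) => /=; lra.
Qed.

Lemma is_cvg_binary_series {R : realType} (b : nat -> bool) :
  cvgn (@binary_series R b).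
Proof.
apply: nondecreasing_is_cvgn.
  apply: nondecreasing_series => i _ _.
  by rewrite divr_ge0// exprn_ge0.
by exists 1 => _ [n _ <-]; have /andP[] := @binary_series_itv R b n.
Qed.

Lemma binary_expansion_itv {R : realType} (b : nat -> bool) (a : R) :
  binary_expansion b a -> 0 <= a <= 1.
Proof.
move=> ba; have ca : cvgn (@binary_series R b) by apply/cvg_ex; exists a.
rewrite -(cvg_lim (@Rhausdorff R) ba); apply/andP; split.
  by apply: limr_ge => //; apply: nearW => n; have /andP[] := @binary_series_itv R b n.
by apply: limr_le => //; apply: nearW => n; have /andP[] := @binary_series_itv R b n.
Qed.

Lemma binary_expansion_shift {R : realType} (b : nat -> bool) (a : R) :
  binary_expansion b a -> binary_expansion (b \o S) (2 * a - (b 0)%:R).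
Proof.
rewrite /binary_expansion => ba.
have -> : @binary_series R (b \o S) =
    (fun n => 2 * binary_series b (n + 1)%N - (b 0)%:R).
  by apply/funext => n; rewrite addn1 binary_series_recl; field.
apply: cvgB; last exact: cvg_cst.
by apply: cvgMr; rewrite cvg_shiftn.
Qed.

Lemma binary_expansion_shiftn {R : realType} (b : nat -> bool) (a : R) (n : nat) :
  binary_expansion b a ->
  exists m : nat, binary_expansion (fun i => b (n + i)%N) (2 ^+ n * a - m%:R).
Proof.
move=> ba; elim: n => [|n [m nm]]; first by exists 0%N; rewrite mul1r subr0.
exists (2 * m + b n)%N.
have -> : 2 ^+ n.+1 * a - (2 * m + b n)%:R = 2 * (2 ^+ n * a - m%:R) - (b (n + 0)%N)%:R.
  by rewrite addn0 exprS natrD natrM; ring.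
have -> : (fun i => b (n.+1 + i)%N) = (fun i => b (n + i)%N) \o S.
  by apply/funext => i /=; rewrite addSnnS.
exact: binary_expansion_shift nm.
Qed.

(** The string consists of the first [L] digits of [phi], chosen greedily.  The
    lemma bounds [a - phi] directly because the expansion of the shifted number is
    again an expansion: one step of the induction halves the distance. *)
Lemma prefix_approx {R : realType} (L : nat) (phi : R) : 0 <= phi <= 1 ->
  exists2 w : seq bool, size w = L &
    forall (b : nat -> bool) (a : R),
      binary_expansion b a -> mkseq b L = w -> `|a - phi| <= 2^-1 ^+ L.
Proof.
elim: L phi => [|L IH] phi phi01.
  exists [::] => // b a /binary_expansion_itv a01 _.
  by rewrite expr0 ler_norml; lra.
pose d : bool := 2^-1 <= phi.
have [|w wL wP] := IH (2 * phi - d%:R).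
  by rewrite /d; case: (leP 2^-1 phi) => /= h; rewrite ?mulr1n ?mulr0n; lra.
exists (d :: w) => [|b a /binary_expansion_shift ba]; first by rewrite /= wL.
rewrite mkseq_recl => -[b0 bw].
have := wP _ _ ba bw; rewrite b0 exprS.
by rewrite !ler_norml; lra.
Qed.

(** Prepending [N] arbitrary digits to the string that approximates [phi]
    forces it to occur at an index at least [N]. *)
Lemma doubling_orbit_dense {R : realType} (a phi : R) (N : nat) :
  expansion_contains_all_strings a -> 0 <= phi <= 1 ->
  exists n m : nat, (N <= n)%N /\ `|2 ^+ n * a - m%:R - phi| <= 2^-1 ^+ N.
Proof.
move=> [b ba ball] phi01.
have [w wN wP] := prefix_approx N phi phi01.
have [n0 n0w] := ball (nseq N false ++ w).
have [m nm] := binary_expansion_shiftn b a (n0 + N) ba.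
exists (n0 + N)%N, m; split; first by rewrite leq_addl.
apply: wP nm _; have := congr1 (drop N) n0w.
rewrite drop_size_cat ?size_nseq// => <-.
rewrite size_cat size_nseq wN /mkseq -map_drop drop_iota add0n addnK.
rewrite -[X in _ = map _ (iota X _)]addn0 iotaDl -map_comp; apply: eq_map => i /=.
by rewrite addnA.
Qed.

Lemma doubling_orbit_dense_cvg {R : realType} (a phi : R) :
  expansion_contains_all_strings a -> 0 <= phi <= 1 ->
  exists nu mu : nat -> nat, (forall k, (k <= nu k)%N) /\
   (2 ^+ nu k * a - (mu k)%:R) @[k --> \oo] --> phi.
Proof.
move=> aall phi01.
have /choice[f fP] k : exists p : nat * nat,
    (k <= p.1)%N /\ `|2 ^+ p.1 * a - p.2%:R - phi| <= 2^-1 ^+ k.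
  by have [n [m nm]] := doubling_orbit_dense a phi k aall phi01; exists (n, m).
exists (fst \o f), (snd \o f); split=> [k|]; first by have [] := fP k.
apply/subr_cvg0/norm_cvg0P.
apply: (@squeeze_cvgr _ _ _ _ (cst 0) (GRing.exp 2^-1)).
- by apply: nearW => k; rewrite normr_ge0/=; have [] := fP k.
- exact: cvg_cst.
- by apply: cvg_expr; rewrite ger0_norm; lra.
Qed.

(** * The exponential and limits in the complex plane *)

Lemma cvg_complex {R : realType} (X Y : R^nat) (x y : R) :
  X @ \oo --> x -> Y @ \oo --> y ->
  ((X n +i* Y n : R[i]^o) @[n --> \oo]) --> (x +i* y : R[i]^o).
Proof.
move=> Xx Yy.
(* A complex number above 0 has no imaginary part. *)
apply/cvgrPdist_le => -[e e']; rewrite ltcE/= => /andP[/eqP-> e0].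
have e20 : 0 < e / 2 by rewrite divr_gt0.
near=> n.
have Xn : `|x - X n| <= e / 2 by near: n; move/cvgrPdist_le : Xx; exact.
have Yn : `|y - Y n| <= e / 2 by near: n; move/cvgrPdist_le : Yy; exact.
rewrite normc_def/= lecR.
have -> : e = Num.sqrt (e ^+ 2) by rewrite sqrtr_sqr gtr0_norm.
apply: ler_wsqrtr.
rewrite -(real_normK (num_real (x - X n))) -(real_normK (num_real (y - Y n))).
have := normr_ge0 (x - X n); have := normr_ge0 (y - Y n); nra.
Unshelve. all: by end_near. Qed.

Lemma cexpE {R : realType} (x y : R) :
  cexp (x +i* y : R[i]^o) = ((expR x * cos y) +i* (expR x * sin y) : R[i]^o).
Proof. by rewrite /cexp; simpc. Qed.

Lemma cvg_cexp {R : realType} (X Y : R^nat) (x y : R) :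
  X @ \oo --> x -> Y @ \oo --> y ->
  (cexp (X n +i* Y n : R[i]^o) @[n --> \oo]) --> cexp (x +i* y : R[i]^o).
Proof.
move=> Xx Yy; rewrite cexpE.
under eq_fun do rewrite cexpE.
by apply: cvg_complex; apply: cvgM;
  apply: continuous_cvg => //; [exact: continuous_expR|exact: continuous_cos
                               |exact: continuous_expR|exact: continuous_sin].
Qed.

(** The argument is [acos (a / r)] up to the sign of the imaginary part. *)
Lemma cexp_surj {R : realType} (z : R[i]^o) : z != 0 ->
  exists x y : R, z = cexp (x +i* y : R[i]^o).
Proof.
case: z => a b z0.
pose r := Num.sqrt (a ^+ 2 + b ^+ 2).
have r2 : r ^+ 2 = a ^+ 2 + b ^+ 2 by rewrite sqr_sqrtr// addr_ge0 ?sqr_ge0.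
have r0 : 0 < r.
  rewrite sqrtr_gt0 lt_neqAle addr_ge0 ?sqr_ge0// andbT eq_sym.
  by rewrite paddr_eq0 ?sqr_ge0// !sqrf_eq0; move: z0; rewrite eq_complex.
have ar : -1 <= a / r <= 1.
  rewrite -ler_norml normrM normfV (gtr0_norm r0) ler_pdivrMr// mul1r.
  by rewrite -sqrtr_sqr ler_wsqrtr// lerDl sqr_ge0.
have sinE : r * sin (acos (a / r)) = `|b|.
  rewrite sin_acos// -[X in X * _](gtr0_norm r0) -sqrtr_sqr -sqrtrM ?sqr_ge0//.
  rewrite mulrBr mulr1 -exprMn mulrCA divff ?gt_eqF// mulr1 r2 addrAC subrr add0r.
  exact: sqrtr_sqr.
have cosE : r * cos (acos (a / r)) = a.
  by rewrite acosK ?in_itv//= mulrC divfK// gt_eqF.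
exists (ln r), (if 0 <= b then acos (a / r) else - acos (a / r)).
rewrite cexpE lnK ?posrE//; case: (leP 0 b) => b0.
  by rewrite cosE sinE ger0_norm.
by rewrite cosN sinN mulrN cosE sinE ltr0_norm// opprK.
Qed.

Lemma cvg_exp2V {R : realType} (nu : nat -> nat) : (forall k, (k <= nu k)%N) ->
  (2^-1 ^+ nu k : R) @[k --> \oo] --> (0 : R).
Proof.
move=> nuk; apply: (@squeeze_cvgr _ _ _ _ (cst 0) (GRing.exp 2^-1)).
- apply: nearW => k; rewrite exprn_ge0//=.
  by apply: ler_wiXn2l => //; lra.
- exact: cvg_cst.
- by apply: cvg_expr; rewrite ger0_norm; lra.
Qed.

Lemma cvg_diff_quotient {R : realType} (f : R -> R) (df : R) (h : R^nat) :
  is_derive (0 : R) 1 f df -> (forall k, h k != 0) -> h @ \oo --> 0 ->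
  ((f (h k) - f 0) / h k) @[k --> \oo] --> df.
Proof.
move=> fdf h0 hcvg.
have /cvgr_dnbhsP fP : (h^-1 *: (f (h *: (1 : R) + 0) - f 0)) @[h --> (0 : R)^'] --> df.
  by rewrite -[df](@derive_val _ _ _ _ _ _ _ fdf); exact: (@ex_derive _ _ _ _ _ _ _ fdf).
have := fP h (conj h0 hcvg).
by apply: cvg_trans; apply: near_eq_cvg; apply: nearW => k /=;
  rewrite /GRing.scale/= mulr1 addr0 mulrC.
Qed.

Lemma cexp_periodic {R : realType} (x y : R) (m : int) :
  cexp (x +i* (y + 2 * pi * m%:~R) : R[i]^o) = cexp (x +i* y : R[i]^o).
Proof.
have periodic_nat z n : cexp (x +i* (z + 2 * pi * n%:R) : R[i]^o) = cexp (x +i* z : R[i]^o).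
  have -> : 2 * pi * n%:R = pi *+ 2 *+ n :> R by rewrite mulr_natr mulr_natl.
  by rewrite !cexpE (periodicn (@cosD2pi R)) (periodicn (@sinD2pi R)).
case: m => n; first exact: periodic_nat.
by rewrite -[LHS](periodic_nat _ n.+1) NegzE mulrNz mulrN subrK.
Qed.

(** Here [s] is the deviation from [n] full turns: the rotation part [i t] only
    keeps [s], while the real part [alpha t] produces the factor [2 ^+ n]. *)
Lemma line_exp {R : realType} (a : R) (n : nat) (s : R) : 0 < a ->
  let alpha : R := ln 2 / (2 * pi) in
  let t : R := 2 * pi * n%:R + s in
  cexp ((ln (2 * pi * a) +i* (pi / 2) : R[i]^o) + t%:C * ('i%C + alpha%:C)) =
  ((- (2 * pi * a * 2 ^+ n * (expR (alpha * s) * sin s))) +i*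
   (2 * pi * a * 2 ^+ n * (expR (alpha * s) * cos s)) : R[i]^o).
Proof.
move=> a0 alpha t.
have pi0 : 0 < pi :> R := pi_gt0 R.
have A0 : 0 < 2 * pi * a by rewrite !mulr_gt0.
have -> : (ln (2 * pi * a) +i* (pi / 2) : R[i]^o) + t%:C * ('i%C + alpha%:C) =
    ((ln (2 * pi * a) + n%:R * ln 2 + alpha * s) +i*
     (s + pi / 2 + pi *+ 2 *+ n) : R[i]^o).
  simpc; congr (_ +i* _).
    by rewrite /t /alpha; field; lra.
  by rewrite /t -(mulr_natr (pi *+ 2)) -(mulr_natl pi 2); ring.
rewrite cexpE !expRD lnK ?posrE// expRM_natl lnK ?posrE//.
rewrite (periodicn (@cosD2pi R)) (periodicn (@sinD2pi R)) cosDpihalf sinDpihalf.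
by congr (_ +i* _); ring.
Qed.

Lemma is_derive0_scale {R : realType} (f : R -> R) (df c : R) :
  is_derive (0 : R) 1 f df -> is_derive (0 : R) 1 (fun t => f (c * t)) (df * c).
Proof.
move=> fdf; apply: (@is_derive1_comp R f (fun t => c * t) 0 df c).
  by rewrite mulr0.
by apply: (is_derive_eq (is_deriveZ c (is_derive_id _ _))); exact: mulr1.
Qed.

(** The target [x + i y] fixes [tau] by [x = - A tau], and then [phi] as the
    fractional part of [psi], where [2 pi psi = y - A alpha tau] corrects the
    argument by the limit of the difference quotient. *)
Lemma cexp_in_closure {R : realType} (a : R) : 0 < a ->
  expansion_contains_all_strings a ->
  forall x y : R,
  closure ((cexp \o cexp) @` line (ln 2 / (2 * pi))
     (ln (2 * pi * a) +i* (pi / 2) : R[i]^o)) (cexp (x +i* y : R[i]^o)).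
Proof.
move=> a0 aall x y.
have pi0 : 0 < pi :> R := pi_gt0 R.
set alpha : R := ln 2 / (2 * pi).
pose A : R := 2 * pi * a.
have A0 : 0 < A by rewrite !mulr_gt0.
pose tau := - x / A.
have tauE : A * tau = - x by rewrite mulrC divfK// gt_eqF.
pose psi := (y + alpha * x) / (2 * pi).
pose phi := psi - (Num.floor psi)%:~R.
have phi01 : 0 <= phi <= 1.
  by rewrite /phi subr_ge0 floor_le/= lerBlDl -(intrD _ _ 1) ltW// floorD1_gt.
have [nu [mu [nuk numu]]] := doubling_orbit_dense_cvg a phi aall phi01.
pose h k : R := 2^-1 ^+ nu k.
have h_neq0 k : h k != 0 by rewrite expf_neq0.
have hV k : 2 ^+ nu k = (h k)^-1 by rewrite /h exprVn invrK.
have h0 : h @ \oo --> 0 by exact: cvg_exp2V.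
pose f t : R := expR (alpha * (tau * t)) * sin (tau * t).
pose g t : R := expR (alpha * (tau * t)) * cos (tau * t).
have exp_lin : is_derive (0 : R) 1 (fun t => expR (alpha * (tau * t))) (alpha * tau).
  have := is_derive0_scale _ _ tau (is_derive0_scale _ _ alpha (is_derive_expR (0 : R))).
  by rewrite expR0 mul1r.
have sin_lin := is_derive0_scale _ _ tau (is_derive_sin (0 : R)).
have cos_lin := is_derive0_scale _ _ tau (is_derive_cos (0 : R)).
have fdf : is_derive (0 : R) 1 f tau.
  apply: (is_derive_eq (is_deriveM exp_lin sin_lin)).
  by rewrite !mulr0 expR0 cos0 sin0 mul1r scale0r addr0 scale1r.
have gdg : is_derive (0 : R) 1 g (alpha * tau).
  apply: (is_derive_eq (is_deriveM exp_lin cos_lin)).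
  by rewrite !mulr0 cos0 sin0 oppr0 mul0r scaler0 add0r scale1r.
have Xx : (- A * ((f (h k) - f 0) / h k)) @[k --> \oo] --> x.
  have -> : x = - A * tau by rewrite mulNr tauE opprK.
  by apply: cvgMr; exact: cvg_diff_quotient.
have Yy : (2 * pi * (2 ^+ nu k * a - (mu k)%:R) + A * ((g (h k) - g 0) / h k))
    @[k --> \oo] --> 2 * pi * phi + A * (alpha * tau).
  by apply: cvgD; apply: cvgMr => //; exact: cvg_diff_quotient.
have -> : cexp (x +i* y : R[i]^o) =
    cexp (x +i* (2 * pi * phi + A * (alpha * tau)) : R[i]^o).
  rewrite -(cexp_periodic _ _ (- Num.floor psi)); congr (cexp (_ +i* _)).
  rewrite /phi mulrNz mulrBr [A * _]mulrCA tauE.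
  have -> : 2 * pi * psi = y + alpha * x.
    by rewrite mulrC divfK// gt_eqF// mulr_gt0.
  by ring.
have lim_cexp := cvg_cexp _ _ _ _ Xx Yy.
refine (@closed_cvg _ _ \oo _ _ (closure _) _ _ _ lim_cexp).
  exact: closed_closure.
apply: nearW => k; apply: subset_closure => /=.
pose t := 2 * pi * (nu k)%:R + tau * h k.
exists ((ln (2 * pi * a) +i* (pi / 2) : R[i]^o) + t%:C * ('i%C + alpha%:C)).
  by exists t.
have lineE := line_exp a (nu k) (tau * h k) a0.
rewrite /comp lineE -/alpha hV -/A -/(f (h k)) -/(g (h k)).
(* [mu k] full turns bring the imaginary part back to a bounded value. *)
rewrite -[LHS](cexp_periodic _ _ (- (mu k)%:Z)); congr (cexp (_ +i* _)).
  by rewrite /f !mulr0 sin0 mulr0 subr0; ring.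
rewrite /g !mulr0 expR0 cos0 mulrNz /A; field.
exact: h_neq0.
Qed.

(** * The closure of the image *)

Lemma champernowne_expansion (R : realType) :
  expansion_contains_all_strings (champernowne R).
Proof.
exists champernowne_digit; last exact: champernowne_contains_string.
exact: is_cvg_binary_series.
Qed.

Theorem theorem4 (R : realType) (a : R) :
  0 < a < 1 ->
  a = champernowne R \/ expansion_contains_all_strings a ->
  let p_star : R[i]^o := ln (2 * pi * a) +i* (pi / 2) in
  let alpha_star : R := ln 2 / (2 * pi) in
  closure ((cexp \o cexp) @` line alpha_star p_star) = [set: R[i]^o].
Proof.
move=> /andP[a0 _] aP p_star alpha_star.
have aall : expansion_contains_all_strings a.
  by case: aP => [->|//]; exact: champernowne_expansion.
set S := _ @` _.
have nonzero z : z != 0 -> closure S z.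
  by move=> /cexp_surj[x [y ->]]; exact: cexp_in_closure.
apply/seteqP; split=> // z _; have [->|/nonzero//] := eqVneq z 0.
(* 0 is a limit of the positive reals [1 / (n + 1)]. *)
have u0 := cvg_complex _ _ _ _ (@cvg_harmonic R) (cvg_cst (0 : R)).
refine (@closed_cvg _ _ \oo _ _ (closure S) _ _ _ (u0 _)).
  exact: closed_closure.
by apply: nearW => n; apply: nonzero; rewrite eq_complex/= eqxx andbT gt_eqF.
Qed.
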